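(* Let $k\ge1$. The Jacobian determinant $\det D\sigma_k(z)$ is a function of $z_0^2$ and $\underline{z}^2$. More precisely, for all $z=(z_0,\underline{z})\in\mathbb{C}^4$, $$\det D\sigma_k(z)=k^2\,(z_0^2+\underline{z}^2)^{k-1}\,\big[p_1^{k-1}(z_0,\underline{z}^2)\big]^2,$$ where $$p_1^{k-1}(z_0,\underline{z}^2)=(z_0^2+\underline{z}^2)^{\frac{k-1}{2}}\,U_{k-1}\!\left(\frac{z_0}{(z_0^2+\underline{z}^2)^{1/2}}\right)\quad\text{(when } z_0^2+\underline{z}^2\neq 0\text{)}$$ and $U_{k-1}$ denotes the Chebyshev polynomial of the second kind of degree $k-1$.
   Context: Points of $\mathbb{C}^4$ are written $z=(z_0,\underline{z})$ with $\underline{z}=(z_1,z_2,z_3)$, and $\underline{z}^2:=z_1^2+z_2^2+z_3^2\in\mathbb{C}$. For an integer $k\ge1$, $p_0^k$ and $p_1^{k-1}$ are the two-variable integer polynomials determined by $(x+\imath y)^k=p_0^k(x,y^2)+\imath\, y\,p_1^{k-1}(x,y^2)$ for $x,y\in\mathbb{R}$. The map $\sigma_k:\mathbb{C}^4\to\mathbb{C}^4$ is $$\sigma_k(z_0,\underline{z})=\big(p_0^k(z_0,\underline{z}^2),\ p_1^{k-1}(z_0,\underline{z}^2)\,\underline{z}\big)$$ (the $k$-th power map of the algebra $\mathbb{C}\otimes_{\mathbb{R}}\mathbb{H}\cong\mathbb{C}^4$). $D\sigma_k$ is the complex $4\times4$ Jacobian matrix. In the formula with Chebyshev polynomials, the same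 choice of square root $(z_0^2+\underline{z}^2)^{1/2}$ is used in both occurrences, with $(z_0^2+\underline z^2)^{\frac{k-1}{2}}$ its $(k-1)$-st power. *)

(* Defs.v *)
From HB Require Import structures.
From mathcomp Require Import all_boot all_order all_algebra.
From mathcomp Require Import all_classical all_reals all_analysis.
From mathcomp Require Import complex.
From mathcomp Require Import ring.

Set Implicit Arguments.
Unset Strict Implicit.
Unset Printing Implicit Defensive.

Import Order.TTheory GRing.Theory Num.Theory.
Import numFieldNormedType.Exports.
Local Open Scope ring_scope.
Local Open Scope complex_scope.

(* Two-variable integer polynomials are taken in {poly {poly int}}: the outer
   variable is the first one, the inner variable (in the coefficients) the
   second one. *)
Definition eval2 (S : comNzRingType) (p : {poly {poly int}}) (x y : S) : S :=
  (map_poly (map_poly intr) p).[x%:P].[y].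

(* (x + iy)^k = p0(x, y^2) + i y p1(x, y^2) for all real x, y; for k >= 1 the
   polynomial p1 is the one with upper index k - 1. *)
Definition power_polys (R : realType) (k : nat) (p0 p1 : {poly {poly int}}) :
    Prop :=
  forall x y : R,
    (x +i* y) ^+ k =
      (eval2 p0 x (y ^+ 2))%:C + 'i * y%:C * (eval2 p1 x (y ^+ 2))%:C.

Section Sigma.
Variable S : comNzRingType.
Implicit Type z : 'rV[S]_4.

Definition vecsq z : S := \sum_(j < 3) z 0 (lift ord0 j) ^+ 2.

Definition sigma (p0 p1 : {poly {poly int}}) z : 'rV[S]_4 :=
  \row_(i < 4) (if i == ord0 then eval2 p0 (z 0 ord0) (vecsq z)
                else eval2 p1 (z 0 ord0) (vecsq z) * z 0 i).

End Sigma.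

(* Chebyshev polynomials of the second kind: U_0 = 1, U_1 = 2X,
   U_{n+2} = 2X U_{n+1} - U_n. *)
Fixpoint chebyshevU (S : comNzRingType) (n : nat) : {poly S} :=
  match n with
  | 0 => 1
  | n'.+1 =>
      match n' with
      | 0 => 'X *+ 2
      | m.+1 => 'X *+ 2 * chebyshevU S n' - chebyshevU S m
      end
  end.

Section Eval2Theory.
Variable S : comNzRingType.
Implicit Types (p q : {poly {poly int}}) (x y : S).

Lemma eval2D p q x y : eval2 (p + q) x y = eval2 p x y + eval2 q x y.
Proof. by rewrite /eval2 rmorphD !hornerD. Qed.

Lemma eval2N p x y : eval2 (- p) x y = - eval2 p x y.
Proof. by rewrite /eval2 rmorphN !hornerN. Qed.

Lemma eval2M p q x y : eval2 (p * q) x y = eval2 p x y * eval2 q x y.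
Proof. by rewrite /eval2 rmorphM !hornerM. Qed.

Lemma eval2X x y : eval2 'X x y = x.
Proof. by rewrite /eval2 map_polyX hornerX hornerC. Qed.

Lemma eval2Y x y : eval2 'X%:P x y = y.
Proof. by rewrite /eval2 map_polyC hornerC /= map_polyX hornerX. Qed.

Lemma eval20 x y : eval2 0 x y = 0.
Proof. by rewrite /eval2 rmorph0 !horner0. Qed.

Lemma eval21 x y : eval2 1 x y = 1.
Proof. by rewrite /eval2 rmorph1 !hornerE. Qed.

End Eval2Theory.

Lemma power_polys_exist (R : realType) (k : nat) :
  exists p0 p1 : {poly {poly int}}, power_polys R k p0 p1.
Proof.
elim: k => [|k [p0 [p1 IH]]].
  exists 1, 0 => x y.
  by rewrite expr0 eval20 eval21 mulr0 addr0.
exists ('X * p0 - 'X%:P * p1), (p0 + 'X * p1) => x y.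
rewrite exprS IH !(eval2D, eval2N, eval2M, eval2X, eval2Y).
by apply/eqP; rewrite eq_complex /=; apply/andP; split; apply/eqP; ring.
Qed.

(* Main.v *)
Require Import Defs.
From HB Require Import structures.
From mathcomp Require Import all_boot all_order all_algebra.
From mathcomp Require Import all_classical all_reals all_analysis.
From mathcomp Require Import complex ring.
Import Order.TTheory GRing.Theory Num.Theory.
Import numFieldNormedType.Exports.
Local Open Scope ring_scope.
Local Open Scope complex_scope.

(** Over the algebra generated by x and a square root s of - v, write
    (x + s)^k = a_k + s b_k; the pair (a_k, b_k) is [power_pair x v k].  The
    defining identity of p0 and p1 on real points says that they take the
    values a_k and b_k at (x, y^2), y != 0.  These points are Zariski dense, so
    p0 and p1 are a_k and b_k as formal polynomials
    ([power_polys_unique]) and may be evaluated anywhere.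

    Since d(x + s)^k = k (x + s)^(k-1) d(x + s), the functions a_k and b_k
    satisfy Cauchy-Riemann equations ([is_diff_power_pair]).  Put u for the
    vector part of z, v = u^2, B = b_k, alpha = k a_(k-1), beta = k b_(k-1), and
    c for twice the derivative of b_k in v.  With the partial derivatives of
    sigma as rows, the Jacobian matrix is
      [  alpha      beta u       ]
      [ - beta u^T  B I + c u^T u ].
    An orthogonal change of basis adapted to u explains its determinant:
    the two directions orthogonal to u contribute B^2, and the remaining 2 x 2
    block contributes alpha (B + v c) + v beta^2 ([det_jacobian_shape]).
    The last Cauchy-Riemann equation is B + v c = alpha, so this
    block equals alpha^2 + v beta^2 = k^2 (a_(k-1)^2 + v b_(k-1)^2), and
    multiplicativity of the norm x^2 + v of x + s ([power_pair_norm]) turns it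
    into k^2 (x^2 + v)^(k-1).

    Changing the sign of x changes b_k at most by a sign ([power_pair_opp]);
    hence b_k^2, and with it the determinant, depends on x only through x^2.
    Finally x + s is a root of T^2 - 2 x T + (x^2 + v), so b_k obeys the
    corresponding three-term recurrence, which is that of the Chebyshev
    polynomials U after rescaling by w with w^2 = x^2 + v
    ([power_pair_chebyshev]). *)

Set Implicit Arguments.
Unset Strict Implicit.
Unset Printing Implicit Defensive.

(** * Powers of x + s with s^2 = - v *)

Section PowerPair.
Variable S : comNzRingType.
Implicit Types x v : S.

Fixpoint power_pair x v (k : nat) : S * S :=
  if k is n.+1 then
    let ab := power_pair x v n in (x * ab.1 - v * ab.2, ab.1 + x * ab.2)
  else (1, 0).

(** The norm x^2 + v of x + s is multiplicative. *)
Lemma power_pair_norm x v k :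
  (power_pair x v k).1 ^+ 2 + v * (power_pair x v k).2 ^+ 2 = (x ^+ 2 + v) ^+ k.
Proof.
elim: k => [|k IH] /=; first by rewrite expr0 expr1n expr0n /= mulr0 addr0.
by rewrite [RHS]exprS -IH; ring.
Qed.

(** The conjugate of x + s is x - s = - (- x + s), and conjugation commutes with
    powers. *)
Lemma power_pair_opp x v k :
  power_pair (- x) v k =
    ((-1) ^+ k * (power_pair x v k).1, - (-1) ^+ k * (power_pair x v k).2).
Proof.
elim: k => [|k IH] /=; first by rewrite expr0 mul1r mulr0.
by rewrite IH /=; congr (_, _); rewrite exprS; ring.
Qed.

(** The trace of x + s is 2 x and its norm is x^2 + v. *)
Lemma power_pair_recurrence x v k :
  (power_pair x v k.+2).2 =
    2 * x * (power_pair x v k.+1).2 - (x ^+ 2 + v) * (power_pair x v k).2.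
Proof. by rewrite /=; ring. Qed.

(** Writing x = w y gives x^2 + v = w^2, and w^k U_k(y) then satisfies the same
    recurrence as b_(k+1). The equation for x avoids dividing by w. *)
Lemma power_pair_chebyshev x v w y k :
  w * y = x -> w ^+ 2 = x ^+ 2 + v ->
  (power_pair x v k.+1).2 = w ^+ k * (chebyshevU S k).[y].
Proof.
move=> wyx w2.
(* The recurrence has order two, so two consecutive indices are carried. *)
suff [] : (power_pair x v k.+1).2 = w ^+ k * (chebyshevU S k).[y] /\
  (power_pair x v k.+2).2 = w ^+ k.+1 * (chebyshevU S k.+1).[y] by [].
elim: k => [|k [IH1 IH2]].
  by rewrite /= !hornerE /= -?wyx; split; ring.
split=> //; rewrite power_pair_recurrence IH1 IH2 -w2 -wyx.
have -> : chebyshevU S k.+2 = 'X *+ 2 * chebyshevU S k.+1 - chebyshevU S k.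
  by [].
rewrite hornerD hornerN hornerM hornerMn hornerX.
move: (chebyshevU S k.+1).[y] (chebyshevU S k).[y] => p q.
by rewrite !exprS; ring.
Qed.

End PowerPair.

(** * Identification of the polynomials *)

(** The pair computed in the polynomial ring itself, with both variables in
    place of x and v, is the universal one. *)
Lemma eval2_power_pair (S : comNzRingType) (x v : S) k :
  (eval2 (power_pair 'X 'X%:P k).1 x v,
   eval2 (power_pair 'X 'X%:P k).2 x v) =
    power_pair x v k.
Proof.
elim: k => [|k IH] /=; first by rewrite eval21 eval20.
by rewrite -IH !(eval2D, eval2N, eval2M, eval2X, eval2Y).
Qed.

Lemma poly_eq0_nat_roots (S : idomainType) (p : {poly S}) (f : nat -> S) :
  injective f -> (forall n, root p (f n)) -> p = 0.
Proof.
move=> f_inj rootp; apply/eqP/negPn/negP => p0.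
have := @max_poly_roots _ p (map f (iota 0 (size p))) p0.
rewrite map_inj_uniq // iota_uniq size_map size_iota ltnn => /(_ _ isT) H.
by suff: false by []; apply: H; apply/allP => _ /mapP[n _ ->].
Qed.

(** The points (x, y^2) with y nonzero are Zariski dense in the plane. The
    axis y = 0 is left out because p1 enters the power identity only through
    y p1(x, y^2). *)
Lemma eval2_inj (R : numDomainType) (p q : {poly {poly int}}) :
  (forall x y : R, y != 0 -> eval2 p x (y ^+ 2) = eval2 q x (y ^+ 2)) ->
  p = q.
Proof.
move=> epq; apply/eqP; rewrite -subr_eq0; apply/eqP; set d := p - q.
have ed x y : y != 0 -> eval2 d x (y ^+ 2) = 0 :> R.
  by move=> y0; rewrite /d eval2D eval2N epq // subrr.
suff d0 : map_poly (map_poly (intr : int -> R)) d = 0.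
  apply: (@map_inj_poly _ _ (map_poly (intr : int -> R)));
    last by rewrite d0 map_poly0.
  - exact: map_inj_poly (@intr_inj R) _.
  - exact: map_poly0.
(* Outer variable: every natural number is a root of the outer polynomial,
   because each specialisation has the squares n^2, n > 0, as roots. *)
apply: (@poly_eq0_nat_roots _ _ (fun n => n%:R%:P)) => [m n /polyC_inj/eqP|m].
  by rewrite eqr_nat => /eqP.
apply/eqP.
apply: (@poly_eq0_nat_roots _ _ (fun n => n.+1%:R ^+ 2)) => [a b /eqP|n].
  by rewrite -!natrX eqr_nat eqn_exp2r // => /eqP[].
by apply/eqP/ed; rewrite pnatr_eq0.
Qed.

Lemma power_polys_unique (R : realType) (k : nat) (p0 p1 : {poly {poly int}}) :
  power_polys R k p0 p1 -> (p0, p1) = power_pair 'X 'X%:P k.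
Proof.
move=> hp; rewrite [RHS]surjective_pairing.
have cartesian (x y : R) : (x +i* y) ^+ k =
    (power_pair x (y ^+ 2) k).1 +i* (y * (power_pair x (y ^+ 2) k).2).
  elim: k {hp} => [|k IH]; first by rewrite expr0 /= mulr0.
  by rewrite exprS IH; apply/eqP; rewrite eq_complex /=; apply/andP; split;
    apply/eqP; ring.
have E (x y : R) : eval2 p0 x (y ^+ 2) = (power_pair x (y ^+ 2) k).1 /\
    y * eval2 p1 x (y ^+ 2) = y * (power_pair x (y ^+ 2) k).2.
  by have := hp x y; rewrite cartesian => /eqP; rewrite eq_complex /=;
    case/andP => /eqP -> /eqP ->; split; ring.
congr (_, _); apply: (@eval2_inj R) => x y y0; have [E1 E2] := E x y;
  rewrite -eval2_power_pair /= in E1 E2; first exact: E1.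
exact: (mulfI y0).
Qed.

(** * The determinant of the Jacobian matrix *)

(** In a basis consisting of the scalar axis, u and two vectors orthogonal to
    u, the matrix is block diagonal, with d on the two orthogonal directions;
    the other factor is the determinant of the remaining 2 x 2 block.  Such a
    basis needs a square root of u^2 and its inverse, but the resulting identity
    is polynomial; the proof expands the determinant instead. *)
Lemma det_jacobian_shape (S : comNzRingType) (A : 'M[S]_4) (u : 'rV[S]_4)
    (a b c d : S) :
  (forall i j, A i j =
     if i == ord0 then if j == ord0 then a else b * u 0 j
     else if j == ord0 then - b * u 0 i
     else c * u 0 i * u 0 j + d *+ (i == j)) ->
  \det A = d ^+ 2 * (a * (d + vecsq u * c) + vecsq u * b ^+ 2).
Proof.
move=> AE.
(* With entries indexed by natural numbers, the nested lifts produced by the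
   cofactor expansion reduce by computation. *)
pose w (n : nat) := u 0 (inord n).
pose F (i j : nat) :=
     if i == 0%N then if j == 0%N then a else b * w j
     else if j == 0%N then - b * w i
     else c * w i * w j + d *+ (i == j).
have -> : A = \matrix_(i, j) F i j.
  by apply/matrixP => i j; rewrite AE mxE /F /w !inord_val.
have -> : vecsq u = w 1%N ^+ 2 + w 2%N ^+ 2 + w 3%N ^+ 2.
  rewrite /vecsq !big_ord_recl big_ord0 addr0 addrA /w.
  by congr (_ ^+ 2 + _ ^+ 2 + _ ^+ 2); congr (u 0 _);
    apply/val_inj; rewrite /= inordK.
clearbody w; clear.
do 3![rewrite !(expand_det_row _ ord0) !big_ord_recl !big_ord0 /cofactor /=].
rewrite !det_mx11 /row' /col' !mxE /bump /=.
rewrite /F /=.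
by ring.
Qed.

Section Jacobian.
Variable K : numFieldType.

Lemma is_diff_coord n (z : 'rV[K]_n) (j : 'I_n) :
  is_diff z (fun y : 'rV[K]_n => y 0 j) (fun h => h 0 j).
Proof.
apply: DiffDef; first exact: differentiable_coord.
have coord_cont : continuous (fun y : 'rV[K]_n => y 0 j).
  exact: coord_continuous.
have lin : linear (fun y : 'rV[K]_n => y 0 j : K).
  by move=> a u v; rewrite !mxE.
pose cM := GRing.isLinear.Build _ _ _ _ _ lin.
pose c : {linear 'rV[K]_n -> K} := HB.pack (fun y : 'rV[K]_n => y 0 j : K) cM.
by rewrite -[X in 'd X _]/(c : 'rV[K]_n -> K) diff_lin.
Qed.

Lemma jacobian_coord m n (f : 'rV[K]_m -> 'rV[K]_n) (z : 'rV[K]_m)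
    (D : 'I_n -> 'rV[K]_m -> K) :
  (forall j, is_diff z (fun y => f y 0 j) (D j)) ->
  forall i j, jacobian f z i j = D j (delta_mx 0 i).
Proof.
move=> fD i j.
have df : differentiable f z.
  have -> : f = \sum_j (fun y => f y 0 j *: delta_mx 0 j).
    by apply/funext => y; rewrite fct_sumE [LHS]row_sum_delta.
  apply: differentiable_sum => l; apply: differentiableZl.
  exact: (@ex_diff _ _ _ _ _ _ _ (fD l)).
have := @diff_val _ _ _ _ _ _ _
  (is_diff_comp (differentiableP df) (is_diff_coord (f z) j)).
by rewrite (@diff_val _ _ _ _ _ _ _ (fD j)) => ->; rewrite !mxE.
Qed.

Lemma is_diff_sum (V W : normedModType K) n (f df : 'I_n -> V -> W) (z : V) :
  (forall i, is_diff z (f i) (df i)) ->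
  is_diff z (\sum_i f i) (\sum_i df i).
Proof.
move=> fdf; elim/big_rec2: _ => [|i dg g _ gdg]; first exact: is_diff_cst.
exact: is_diffD.
Qed.

Lemma is_diff_vecsq (z : 'rV[K]_4) :
  is_diff z (@vecsq K)
    (2 *: (fun h => \sum_(j < 3) z 0 (lift ord0 j) * h 0 (lift ord0 j))).
Proof.
have -> : @vecsq K = \sum_(j < 3) (fun y : 'rV[K]_4 => y 0 (lift ord0 j)) ^+ 2.
  by apply/funext => y; rewrite fct_sumE.
apply: (is_diff_eq (is_diff_sum
  (fun j : 'I_3 => is_diffX 1 (is_diff_coord z (lift ord0 j))))).
apply/funext => h; rewrite fct_sumE fctE /GRing.scale /= mulr_sumr.
by apply: eq_bigr => j _; rewrite /GRing.scale /= expr1 mulrA.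
Qed.

(** These are the Cauchy-Riemann equations of (x + s)^k. The differential of v
    is written 2 q because v is a square in the variables: c is then twice the
    derivative of b_k in v.  It is only characterised after multiplication by v,
    since solving for it would divide by v. At k = 0 the predecessor is
    harmless, its value being multiplied by k. *)
Lemma is_diff_power_pair (V : normedModType K) (x v : V -> K) (dx q : V -> K)
    (z : V) (k : nat) :
  is_diff z x dx -> is_diff z v (2 *: q) ->
  is_diff z (fun y => (power_pair (x y) (v y) k).1)
    (k%:R * (power_pair (x z) (v z) k.-1).1 *: dx -
     k%:R * (power_pair (x z) (v z) k.-1).2 *: q) /\
  exists2 c : K,
    v z * c =
      k%:R * (power_pair (x z) (v z) k.-1).1 - (power_pair (x z) (v z) k).2 &
    is_diff z (fun y => (power_pair (x y) (v y) k).2)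
      (k%:R * (power_pair (x z) (v z) k.-1).2 *: dx + c *: q).
Proof.
move=> xdx vq; elim: k => [|k [IHa [c vc IHb]]] /=.
  split; first by apply: is_diff_eq; rewrite !mul0r !scale0r subr0.
  exists 0; first by rewrite mulr0 mul0r subr0.
  by apply: is_diff_eq; rewrite mul0r !scale0r addr0.
(* The recursion of the pair from k - 1 to k, multiplied by k so that it also
   holds at k = 0. *)
have E1 : k%:R * (power_pair (x z) (v z) k).1 =
    k%:R * (x z * (power_pair (x z) (v z) k.-1).1 -
            v z * (power_pair (x z) (v z) k.-1).2).
  by case: (k) => [|n] //=; rewrite !mul0r.
have E2 : k%:R * (power_pair (x z) (v z) k).2 =
    k%:R * ((power_pair (x z) (v z) k.-1).1 +
            x z * (power_pair (x z) (v z) k.-1).2).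
  by case: (k) => [|n] //=; rewrite !mul0r.
set a := fun y => (power_pair (x y) (v y) k).1 in IHa *.
set b := fun y => (power_pair (x y) (v y) k).2 in IHb *.
split.
- apply: (is_diff_eq (is_diffB (is_diffM xdx IHa) (is_diffM vq IHb))).
  apply/funext => h; rewrite !fctE /a /b /= -!natr1 /GRing.scale /=.
  have vcq : v z * (c * q h) = (k%:R * (power_pair (x z) (v z) k.-1).1 -
      (power_pair (x z) (v z) k).2) * q h by rewrite mulrA vc.
  rewrite [v z * (_ + _)]mulrDr vcq !mulrDl E1 E2.
  ring.
(* Twice the derivative in v of the recursion b_(k+1) = a_k + x b_k. *)
exists (x z * c - k%:R * (power_pair (x z) (v z) k.-1).2).
  rewrite -[k.+1%:R]natr1 mulrBr [v z * (x z * c)]mulrCA vc mulrDl E1; ring.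
apply: (is_diff_eq (is_diffD IHa (is_diffM xdx IHb))).
apply/funext => h; rewrite !fctE /a /b /= -!natr1 /GRing.scale /=.
rewrite !mulrDl E2.
ring.
Qed.

Lemma det_jacobian_sigma (p0 p1 : {poly {poly int}}) (k : nat) (z : 'rV[K]_4) :
  (p0, p1) = power_pair 'X 'X%:P k ->
  \det (jacobian (sigma p0 p1) z) =
    k%:R ^+ 2 * (z 0 ord0 ^+ 2 + vecsq z) ^+ k.-1
      * eval2 p1 (z 0 ord0) (vecsq z) ^+ 2.
Proof.
move=> Ep.
have Epp (x v : K) : power_pair x v k = (eval2 p0 x v, eval2 p1 x v).
  by rewrite -eval2_power_pair -Ep.
have [Da [c vc Db]] :=
  is_diff_power_pair k (is_diff_coord z ord0) (is_diff_vecsq z).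
rewrite Epp /= in vc.
set dx := fun h : 'rV[K]_4 => h 0 ord0 in Da Db.
set q := fun h : 'rV[K]_4 => \sum_(j < 3) _ in Da Db.
set a := _ * _.1 in vc Da; set b := _ * _.2 in Da Db.
have q_delta i : q (delta_mx 0 i) = if i == ord0 then 0 else z 0 i.
  rewrite /q; case: (unliftP ord0 i) => [l|] -> /=.
    rewrite (bigD1 l) //= mxE !eqxx mulr1 big1 ?addr0 // => j jl.
    by rewrite mxE (inj_eq lift_inj) (negPf jl) andbF mulr0.
  by rewrite big1 // => j _; rewrite mxE mulr0.
pose D (j : 'I_4) : 'rV[K]_4 -> K :=
  if j == ord0 then a *: dx - b *: q
  else fun h => eval2 p1 (z 0 ord0) (vecsq z) * h 0 j +
                z 0 j * (b * dx h + c * q h).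
have DE j : is_diff z (fun y => sigma p0 p1 y 0 j) (D j).
  rewrite /D; case: ifP => j0.
    have -> : (fun y => sigma p0 p1 y 0 j) =
        fun y : 'rV[K]_4 => (power_pair (y 0 ord0) (vecsq y) k).1.
      by apply/funext => y; rewrite mxE j0 Epp.
    exact: Da.
  have -> : (fun y => sigma p0 p1 y 0 j) =
      (fun y : 'rV[K]_4 => (power_pair (y 0 ord0) (vecsq y) k).2) *
      (fun y : 'rV[K]_4 => y 0 j).
    by apply/funext => y; rewrite mxE j0 fctE Epp.
  apply: (is_diff_eq (is_diffM Db (is_diff_coord z j))).
  by apply/funext => h; rewrite !fctE Epp.
have shape i j : jacobian (sigma p0 p1) z i j =
     if i == ord0 then if j == ord0 then a else b * z 0 j
     else if j == ord0 then - b * z 0 i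
     else c * z 0 i * z 0 j + eval2 p1 (z 0 ord0) (vecsq z) *+ (i == j).
  rewrite (jacobian_coord DE) /D; case: (eqVneq j ord0) => [_|j0].
    rewrite !fctE /dx q_delta mxE eqxx /=.
    by case: (eqVneq i ord0) => i0; rewrite /GRing.scale /= -?i0; ring.
  rewrite /dx q_delta !mxE eqxx /= [j == i]eq_sym [ord0 == i]eq_sym.
  case: (eqVneq i ord0) => [->|_]; last by case: (i == j); rewrite /=; ring.
  by rewrite [ord0 == j]eq_sym (negPf j0) /=; ring.
(* By vc the factor d + v c of the 2 x 2 block is a, and the block becomes the
   norm of the pair of index k - 1 times k^2. *)
rewrite (det_jacobian_shape shape) vc -power_pair_norm /a /b; ring.
Qed.

End Jacobian.

Theorem lemma4p1 (R : realType) (k : nat) (hk : (1 <= k)%N)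
    (p0 p1 : {poly {poly int}}) (hp : power_polys R k p0 p1) :
  (exists g : R[i] -> R[i] -> R[i], forall z : 'rV[R[i]]_4,
     \det (jacobian (sigma p0 p1) z) = g (z 0 ord0 ^+ 2) (vecsq z)) /\
  (forall z : 'rV[R[i]]_4,
     \det (jacobian (sigma p0 p1) z) =
       k%:R ^+ 2 * (z 0 ord0 ^+ 2 + vecsq z) ^+ (k - 1)
         * eval2 p1 (z 0 ord0) (vecsq z) ^+ 2) /\
  (forall (z : 'rV[R[i]]_4) (w : R[i]),
     z 0 ord0 ^+ 2 + vecsq z != 0 ->
     w ^+ 2 = z 0 ord0 ^+ 2 + vecsq z ->
     eval2 p1 (z 0 ord0) (vecsq z) =
       w ^+ (k - 1) * (chebyshevU R[i] (k - 1)).[z 0 ord0 / w]).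
Proof.
have Ep := power_polys_unique hp.
have p1E (x v : R[i]) : eval2 p1 x v = (power_pair x v k).2.
  by rewrite -eval2_power_pair -Ep.
have detE (z : 'rV[R[i]]_4) := det_jacobian_sigma z Ep.
rewrite subn1; split; last split; last 1 first.
- move=> z w nz w2; rewrite p1E -{1}(prednK hk).
  apply: power_pair_chebyshev => //; rewrite mulrC divfK //.
  by apply: contraNneq nz => w0; rewrite -w2 w0 expr0n.
- exists (fun s t => k%:R ^+ 2 * (s + t) ^+ k.-1 * eval2 p1 (sqrtC s) t ^+ 2).
  (* The two square roots of z_0^2 are z_0 and - z_0. *)
  move=> z; rewrite detE; congr (_ * _).
  have /eqP := sqrtCK (z 0 ord0 ^+ 2).
  rewrite eqf_sqr => /orP[] /eqP -> //.
  rewrite !p1E power_pair_opp /= exprMn sqrrN -exprM mulnC exprM sqrrN.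
  by rewrite !expr1n mul1r.
- exact: detE.
Qed.
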